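(* Let $\{p^\nu\}_{\nu\in\mathbb N}\subset\Delta_{m-1}$ converge to $p\in\Delta_{m-1}$ and let $\{\theta^\nu\}_{\nu\in\mathbb N}\subset[0,\infty)$ converge to $\theta\ge0$. For $(u,X)\in\mathbb R^m\times\mathbb R^n$ let $$f_1(u,X)=\sum_{j=1}^m(p_j+u_j)g_j(X)+\iota_{\mathcal X}(X)+\tfrac12\theta\|u\|_2^2+\iota_{[0,\infty)^m}(p+u),\qquad \tilde f_1(u,X)=f_1(u,X)+\iota_{(-\infty,0]^m}(u),$$ let $f_1^\nu,\tilde f_1^\nu$ be the same functions with $(p,\theta)$ replaced by $(p^\nu,\theta^\nu)$, and let $\psi_1,\tilde\psi_1,\psi_1^\nu,\tilde\psi_1^\nu:\mathbb R^m\to\overline{\mathbb R}$ be the dual functions associated with $f_1,\tilde f_1,f_1^\nu,\tilde f_1^\nu$, respectively. (i) If $\theta=0$, then $\psi_1^\nu$ hypo-converges to $\psi_1$. (ii) If $\theta>0$, then $\psi_1^\nu$ hypo-converges to $\psi_1$. (iii) For every $\theta\ge0$, $\tilde\psi_1^\nu$ hypo-converges to $\tilde\psi_1$.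
   Context: Scenario tree. Let $T,k\ge 1$ be integers and consider a finite rooted tree with levels $0,1,\dots,T+1$ (the history tree of a finitely supported discrete-time environment process), in which every node at a level $\le T$ has at least one child. For $0\le t\le T$, $I_t$ is the set of nodes at level $t$ ($I_0$ consists of the root), $n_t=|I_t|$, $N_T=\sum_{t=0}^T n_t$, $n=(k+1)N_T$. The terminal nodes (level $T+1$) are labeled $1,\dots,m$. For a node $i$, $i^-$ is its parent and $i^+$ its set of children. The terminal nodes are partitioned into original scenarios $I$ and added critical scenarios $\tilde I$ (all nodes at levels $\le T$ belong to the original tree). Market. Asset prices are $S_t(i)=(S_t^0,S_t^1(i),\dots,S_t^k(i))\in(0,\infty)^{k+1}$ for each node $i$ at level $t$; asset $0$ is risk-free (its price depends only on $t$). For $j\in\tilde I$ and $1\le i\le k$, $S^i_{T+1}(j)=\kappa_j^iS^i_T(j^-)$ with $\kappa_j^i>0$. The original market is arbitrage-free (no self-financing strategy with zero initial wealth has terminal wealth that is nonnegative a.s. and positive with positive probability). The claim is $G_0>0$ and $G_t(i)<0$ for $i\in I_t$, $1\le t\le T$. Probabilities. $\Delta_{m-1}=\{p\in\mathbb R^m_+:\sum_jp_j=1\}$; $p_j$ is the probability of terminal node $j$, with $p_j=0$ for $j\in\tilde I$; $p^\nu$ may charge any scenario. Strategies. $X\in\mathbb R^n$ is a family $X_t(i)\in\mathbb R^{k+1}$, $i\in I_t$, $0\le t\le T$. The (compact, convex) feasible set $\mathcal X$ consists of all $X$ with $X_t(i)\ge0$ componentwise for all $i\in I_t$, $0\le t\le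 T$; $\langle S_0,X_0\rangle\le G_0$; and $\langle S_t(i),X_t(i)-X_{t-1}(i^-)\rangle\le G_t(i)$ for all $i\in I_t$, $1\le t\le T$. Set $g_j(X)=-\langle S_{T+1}(j),X_T(j^-)\rangle$ for $j=1,\dots,m$. $\iota_C$ is the indicator function ($0$ on $C$, $+\infty$ off $C$). The dual function associated with $f:\mathbb R^m\times\mathbb R^n\to\overline{\mathbb R}$ is $\psi(y)=\inf_{(u,X)}\{f(u,X)-\langle y,u\rangle\}$. Convention: $\infty-\infty=\infty$. Epi-convergence: $g^\nu:\mathbb R^N\to\overline{\mathbb R}$ epi-converges to $g$ if for every $x$: (1) $\liminf_\nu g^\nu(x^\nu)\ge g(x)$ for every $x^\nu\to x$; (2) there is $x^\nu\to x$ with $\limsup_\nu g^\nu(x^\nu)\le g(x)$. $g^\nu$ hypo-converges to $g$ if $-g^\nu$ epi-converges to $-g$. *)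

(* Defs.v *)
From HB Require Import structures.
From mathcomp Require Import all_boot all_order all_algebra.
From mathcomp Require Import all_classical all_reals all_analysis.

Set Implicit Arguments.
Unset Strict Implicit.
Unset Printing Implicit Defensive.

Import Order.TTheory GRing.Theory Num.Theory.
Import numFieldNormedType.Exports.

Local Open Scope classical_set_scope.
Local Open Scope ring_scope.

(* The nodes at levels 0, ..., T form the type [node]; the terminal nodes
   (level T+1) are the labels ['I_m], so the added (critical) scenarios can only
   be terminal nodes.  The parent of the root is a junk value, never used. *)
Record scenario_tree (T m : nat) := ScenarioTree {
  node : finType;
  root : node;
  level : node -> nat;
  parent : node -> node;
  tparent : 'I_m -> node;
  critical : {set 'I_m};
  level_max : forall v, (level v <= T)%N;
  level_root : forall v, level v = 0%N <-> v = root;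
  level_parent : forall v, v <> root -> level v = (level (parent v)).+1;
  level_tparent : forall j, level (tparent j) = T;
  has_child : forall v, (level v < T)%N -> exists2 w, w <> root & parent w = v;
  has_tchild : forall v, level v = T -> exists j, tparent j = v
}.

Arguments root {T m} s.

Section market.
Context {R : realType}.

Definition dotp (n : nat) (x y : 'rV[R]_n) : R := \sum_i x 0 i * y 0 i.

(* [price v] is S_t(v) for v at level t <= T and [tprice j] is S_{T+1}(j);
   assets are indexed by 'I_k.+1, the risk-free asset being [ord0] and the
   risky ones [lift ord0 i].  The values [kappa j] matter for critical j only. *)
Record market (k T m : nat) (tr : scenario_tree T m) := Market {
  price : node tr -> 'rV[R]_k.+1;
  tprice : 'I_m -> 'rV[R]_k.+1;
  kappa : 'I_m -> 'I_k -> R;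
  claim : node tr -> R;
  price_gt0 : forall v a, 0 < price v 0 a;
  tprice_gt0 : forall j a, 0 < tprice j 0 a;
  price_risk_free : forall v w, level v = level w ->
    price v 0 ord0 = price w 0 ord0;
  tprice_risk_free : forall i j, tprice i 0 ord0 = tprice j 0 ord0;
  kappa_gt0 : forall j i, j \in critical tr -> 0 < kappa j i;
  tprice_critical : forall j i, j \in critical tr ->
    tprice j 0 (lift ord0 i) = kappa j i * price (tparent tr j) 0 (lift ord0 i);
  claim_root : 0 < claim (root tr);
  claim_lt0 : forall v, v <> root tr -> claim v < 0
}.

Definition simplex (m : nat) : set 'rV[R]_m :=
  [set q | (forall j, 0 <= q 0 j) /\ \sum_j q 0 j = 1].

Section strategies.
Context {k T m : nat} {tr : scenario_tree T m} (M : market k tr).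

(* R^n with n = (k+1) N_T *)
Definition strategy := {ffun node tr -> 'rV[R]_k.+1}.

Definition terminal_wealth (X : strategy) (j : 'I_m) : R :=
  dotp (tprice M j) (X (tparent tr j)).

Definition self_financing (X : strategy) : Prop :=
  forall v, v <> root tr -> dotp (price M v) (X v - X (parent v)) = 0.

(* Arbitrage strategies may sell short.  When p vanishes on the critical
   scenarios, this only involves the original market. *)
Definition arbitrage_free (p : 'rV[R]_m) : Prop :=
  ~ exists X : strategy,
    [/\ self_financing X,
        dotp (price M (root tr)) (X (root tr)) = 0,
        \sum_(j | 0 <= terminal_wealth X j) p 0 j = 1 &
        0 < \sum_(j | 0 < terminal_wealth X j) p 0 j].

Definition feasible : set strategy := [set X : strategy |
  [/\ forall v a, 0 <= X v 0 a,
      dotp (price M (root tr)) (X (root tr)) <= claim M (root tr) &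
      forall v, v <> root tr ->
        dotp (price M v) (X v - X (parent v)) <= claim M v]].

Definition loss (j : 'I_m) (X : strategy) : R := - terminal_wealth X j.

(* In f1 and f1t no summand is -oo, hence the convention for oo - oo
   plays no role. *)
Definition iota_set (E : Type) (C : set E) (x : E) : \bar R :=
  if `[< C x >] then 0%E else +oo%E.

Definition f1 (p : 'rV[R]_m) (theta : R) (u : 'rV[R]_m) (X : strategy) : \bar R :=
  ((\sum_j (p 0 j + u 0 j) * loss j X)%:E
   + iota_set feasible X
   + (2^-1 * theta * dotp u u)%:E
   + iota_set [set x : 'rV[R]_m | forall j, (0 <= x 0 j)%R] (p + u)%R)%E.

Definition f1t (p : 'rV[R]_m) (theta : R) (u : 'rV[R]_m) (X : strategy) : \bar R :=
  (f1 p theta u X + iota_set [set x : 'rV[R]_m | forall j, (x 0 j <= 0)%R] u)%E.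

End strategies.

Definition dual_function (m : nat) (E : Type) (f : 'rV[R]_m -> E -> \bar R)
    (y : 'rV[R]_m) : \bar R :=
  ereal_inf [set (f uX.1 uX.2 - (dotp y uX.1)%:E)%E | uX in [set: 'rV[R]_m * E]].

Definition psi1 (k T m : nat) (tr : scenario_tree T m) (M : market k tr)
    (p : 'rV[R]_m) (theta : R) : 'rV[R]_m -> \bar R :=
  dual_function (f1 M p theta).

Definition psi1t (k T m : nat) (tr : scenario_tree T m) (M : market k tr)
    (p : 'rV[R]_m) (theta : R) : 'rV[R]_m -> \bar R :=
  dual_function (f1t M p theta).

Definition epi_converges (N : nat) (g_ : nat -> 'rV[R]_N -> \bar R)
    (g : 'rV[R]_N -> \bar R) : Prop :=
  forall x : 'rV[R]_N,
    (forall x_ : nat -> 'rV[R]_N, x_ @ \oo --> x ->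
       (g x <= limn_einf (fun nu => g_ nu (x_ nu)))%E) /\
    (exists2 x_ : nat -> 'rV[R]_N, x_ @ \oo --> x &
       (limn_esup (fun nu => g_ nu (x_ nu)) <= g x)%E).

Definition hypo_converges (N : nat) (g_ : nat -> 'rV[R]_N -> \bar R)
    (g : 'rV[R]_N -> \bar R) : Prop :=
  epi_converges (fun nu x => - g_ nu x)%E (fun x => - g x)%E.

End market.

Arguments market R k {T m} tr.

(* Main.v *)
(** In the variable q = p + u the dual functions are infima, over strategies X
   and q in C(p), of a sum over scenarios of
   q_j (g_j(X) - y_j) + theta/2 (q_j - p_j)^2 + y_j p_j,
   where C(p) is the nonnegative orthant for psi_1 and the box [0, p] for its
   tilde version.  The upper hypo-bound holds because every (q, X) is a limit of
   feasible pairs along which the cost converges.  For the lower one, the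
   constant sequence y suffices:
   if theta = 0 then either the dual value is -oo at y or q = 0 is optimal;
   if theta > 0 then, the losses being bounded below on the feasible set,
   truncating q at a fixed level K only decreases the cost, and on [0, K] the
   perturbed costs converge uniformly; in the box [0, p^nu] one replaces q by
   min(q, p).  *)
Require Import Defs.
From mathcomp Require Import all_boot all_order all_algebra.
From mathcomp Require Import all_classical all_reals all_analysis.
From mathcomp Require Import ring lra.
Import Order.TTheory GRing.Theory Num.Theory.
Import numFieldNormedType.Exports.
Local Open Scope classical_set_scope.
Local Open Scope ring_scope.

(** * Estimates for the cost of one scenario, and elementary limits *)

Section real_analysis.
Context {R : realType}.
Implicit Types (u : nat -> \bar R) (q p y a t theta K A : R).

Lemma limn_esup_le_near u (c : \bar R) :
  (\forall n \near \oo, (u n <= c)%E) -> (limn_esup u <= c)%E.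
Proof.
move=> uc; rewrite /limn_esup /limf_esup.
apply: (@le_trans _ _ (ereal_sup (u @` [set n | (u n <= c)%E]))).
  by apply: ereal_inf_lbound; exists [set n | (u n <= c)%E].
by apply: ge_ereal_sup => _ [n /= un <-].
Qed.

(** Here [a] stands for the loss g_j(X); the last term comes from - y u = - y q + y p with u = q -
    p. *)
Definition scenario_cost p theta y a q : R :=
  q * (a - y) + 2^-1 * theta * (q - p) ^+ 2 + y * p.

(** Since q' <= q, a lower bound on [a - y] controls the linear part, so the error is uniform over
    all such [a]. The difference of the costs splits into four terms: moving q (constant A),
    changing theta (K^2), moving the square from (q', p) to (q, p') (2 theta K), and y (p' - p). *)
Lemma scenario_cost_perturb K A p p' theta theta' y a q q' :
  0 <= theta -> 0 <= p <= K -> 0 <= p' <= K -> 0 <= q' -> q' <= q <= K ->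
  q - q' <= `|p' - p| -> - A <= a - y -> 0 <= A ->
  scenario_cost p theta y a q' <= scenario_cost p' theta' y a q
    + (K ^+ 2 * `|theta' - theta| + (A + 2 * theta * K + `|y|) * `|p' - p|).
Proof.
move=> th0 /andP[p0 pK] /andP[p'0 p'K] q'0 /andP[q'q qK] qd aA A0.
rewrite /scenario_cost.
set d := `|p' - p|; set s := `|theta' - theta|.
have d0 : 0 <= d by exact: normr_ge0.
have s0 : 0 <= s by exact: normr_ge0.
have dp1 : p' - p <= d by exact: ler_norm.
have dp2 : p - p' <= d by rewrite /d distrC; exact: ler_norm.
have ss : - s <= theta' - theta.
  by have := ler_norm (- (theta' - theta)); rewrite normrN -/s; lra.
have {}qd : q - q' <= d by exact: qd.
clearbody d s.
have H1 : - (A * d) <= (q - q') * (a - y).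
  have h1 : 0 <= (q - q') * (a - y + A) by apply: mulr_ge0; lra.
  have h2 : 0 <= A * (d - (q - q')) by apply: mulr_ge0; lra.
  nra.
have H2 : - (K ^+ 2 * s) <= 2^-1 * (theta' - theta) * (q - p') ^+ 2.
  have h1 : (q - p') ^+ 2 <= K ^+ 2.
    have h2 : 0 <= (K - (q - p')) * (K + (q - p')) by apply: mulr_ge0; lra.
    nra.
  have h2 : 0 <= (theta' - theta + s) * (q - p') ^+ 2.
    by apply: mulr_ge0; [lra|exact: sqr_ge0].
  have h3 : 0 <= s * (K ^+ 2 - (q - p') ^+ 2) by apply: mulr_ge0; lra.
  have h4 : 0 <= K ^+ 2 * s by apply: mulr_ge0; [exact: sqr_ge0|].
  nra.
have H3 : - (2 * K * d) <= 2^-1 * ((q - p') ^+ 2 - (q' - p) ^+ 2).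
  have h0 : (q - p') ^+ 2 - (q' - p) ^+ 2
    = (q - q' - (p' - p)) * (q + q' - p - p') by ring.
  rewrite h0.
  have : `|(q - q' - (p' - p)) * (q + q' - p - p')| <= (2 * d) * (2 * K).
    by rewrite normrM; apply: ler_pM => //; rewrite ler_norml; lra.
  rewrite ler_norml => /andP[]; lra.
have H4 : theta * - (2 * K * d)
    <= theta * (2^-1 * ((q - p') ^+ 2 - (q' - p) ^+ 2)) by exact: ler_wpM2l.
have H5 : - (`|y| * d) <= y * (p' - p).
  have : `|y * (p' - p)| <= `|y| * d.
    by rewrite normrM ler_wpM2l // ler_norml; lra.
  by rewrite ler_norml => /andP[].
clear -H1 H2 H4 H5; lra.
Qed.

(** For q > K the chord from K to q has slope a - y + theta ((q + K)/2 - p) >= - A + theta (K - 1)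
    >= 0. *)
Lemma scenario_cost_truncate K A p theta y a q :
  p <= 1 -> 1 <= K -> 0 <= theta -> - A <= a - y -> A <= theta * (K - 1) ->
  scenario_cost p theta y a (Num.min q K) <= scenario_cost p theta y a q.
Proof.
move=> p1 K1 th0 aA AK; case: (leP q K) => // Kq.
rewrite -subr_ge0 /scenario_cost.
set e := (X in 0 <= X).
have -> : e = (q - K) * (a - y + theta * (2^-1 * (q + K) - p)).
  by rewrite /e; field.
apply: mulr_ge0; first lra.
have : theta * (K - 1) <= theta * (2^-1 * (q + K) - p) by apply: ler_wpM2l; lra.
lra.
Qed.

Lemma cvg_coord {n : nat} {x_ : nat -> 'rV[R]_n} {x : 'rV[R]_n} j :
  x_ @ \oo --> x -> x_ nu 0 j @[nu --> \oo] --> x 0 j.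
Proof. by move=> xx; exact: cvg_comp xx (@coord_continuous _ _ _ 0 j x). Qed.

Lemma cvg_sumr {n : nat} (x_ : 'I_n -> nat -> R) (x : 'I_n -> R) :
  (forall j, x_ j nu @[nu --> \oo] --> x j) ->
  \sum_j x_ j nu @[nu --> \oo] --> \sum_j x j.
Proof. by move=> xx; apply: cvg_big => //; exact: add_continuous. Qed.

Lemma simplex_coord {m : nat} {q : 'rV[R]_m} :
  simplex q -> forall j, 0 <= q 0 j <= 1.
Proof.
move=> [q0 q1] j; rewrite q0 /= -q1 (bigD1 j) //= lerDl.
exact: sumr_ge0.
Qed.

End real_analysis.

(** * Boundedness of feasible strategies *)

Lemma dotp_le_scale {R : realType} n (w s x : 'rV[R]_n) :
  (forall a, 0 <= w 0 a) -> (forall a, 0 < s 0 a) -> (forall a, 0 <= x 0 a) ->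
  dotp w x <= (\sum_a w 0 a / s 0 a) * dotp s x.
Proof.
move=> w0 s0 x0; rewrite /dotp mulr_sumr; apply: ler_sum => a _.
have sx0 : 0 <= s 0 a * x 0 a by rewrite mulr_ge0 // ltW.
rewrite [leLHS](_ : _ = w 0 a / s 0 a * (s 0 a * x 0 a)); last first.
  by rewrite mulrA divfK // gt_eqF.
apply: ler_wpM2r => //; rewrite (bigD1 a) //= lerDl.
by apply: sumr_ge0 => b _; rewrite divr_ge0 // ltW.
Qed.

Section dual_values.
Context {R : realType} {k T m : nat} {tr : scenario_tree T m}.
Variable M : market R k tr.
Implicit Types (p q y u : 'rV[R]_m) (theta : R).
Implicit Types (X : strategy (R := R) (k := k) (tr := tr)).

(** Induction on the level. The budget constraint at v bounds the value of X(v) by the claim plus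
    the value of X(parent v) at the prices of v. The latter is a nonnegative functional other than
    pricing at the parent, which is why [w] is arbitrary; positive prices convert value bounds into
    bounds for [w]. *)
Lemma feasible_dotp_bounded (v : node tr) (w : 'rV[R]_k.+1) :
  (forall a, 0 <= w 0 a) ->
  exists B, forall X, feasible M X -> dotp w (X v) <= B.
Proof.
have [n] := ubnP (level v); elim: n => // n IH in v w *.
rewrite ltnS => vn w0.
pose c := \sum_a w 0 a / price M v 0 a.
have c0 : 0 <= c.
  by apply: sumr_ge0 => b _; rewrite divr_ge0 // ltW // price_gt0.
have wc X : feasible M X -> dotp w (X v) <= c * dotp (price M v) (X v).
  by move=> [X0 _ _]; apply: dotp_le_scale => // a; exact: price_gt0.
have [vr|/eqP vr] := eqVneq v (Defs.root tr).
  exists (c * claim M v) => X XF; apply: le_trans (wc _ XF) _.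
  by apply: ler_wpM2l => //; case: XF => _ h _; rewrite vr.
have [||B HB] := IH (parent v) (price M v).
- by rewrite (level_parent vr) in vn.
- by move=> a; rewrite ltW // price_gt0.
exists (c * (claim M v + B)) => X XF; apply: le_trans (wc _ XF) _.
apply: ler_wpM2l => //; have := HB _ XF.
case: XF => _ _ /(_ _ vr).
rewrite /dotp [in X in X -> _](eq_bigr (fun a => price M v 0 a * X v 0 a
  - price M v 0 a * X (parent v) 0 a)); last first.
  by move=> a _; rewrite !mxE mulrBr.
rewrite sumrB; lra.
Qed.

Lemma feasible_loss_bounded y :
  exists2 A, 0 <= A &
    forall X, feasible M X -> forall j, - A <= loss M j X - y 0 j.
Proof.
have /fin_all_exists[B HB] : forall j, exists B,
    forall X, feasible M X -> terminal_wealth M X j <= B.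
  move=> j; apply: feasible_dotp_bounded => a.
  by rewrite ltW // tprice_gt0.
(* The sum dominates each of its nonnegative terms, so one constant serves every scenario. *)
exists (\sum_j (`|B j| + `|y 0 j|)).
  by apply: sumr_ge0 => j _; rewrite addr_ge0.
move=> X XF j; rewrite (bigD1 j) //= /loss.
have := HB j X XF; have := ler_norm (B j); have := ler_norm (y 0 j).
have : 0 <= \sum_(i | i != j) (`|B i| + `|y 0 i|).
  by apply: sumr_ge0 => i _; rewrite addr_ge0.
lra.
Qed.

(** * The dual functions as infima over q = p + u and X *)

Definition total_cost p theta y q X : R :=
  \sum_j scenario_cost (p 0 j) theta (y 0 j) (loss M j X) (q 0 j).

Definition dual_value (C : set 'rV[R]_m) p theta y : \bar R :=
  ereal_inf [set (total_cost p theta y z.1 z.2)%:E | z in C `*` feasible M].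

Definition nonneg : set 'rV[R]_m := [set q | forall j, 0 <= q 0 j].

Definition nonneg_below p : set 'rV[R]_m :=
  [set q | forall j, 0 <= q 0 j <= p 0 j].

Lemma dual_value_le {C : set 'rV[R]_m} {p theta y q X} : C q -> feasible M X ->
  (dual_value C p theta y <= (total_cost p theta y q X)%:E)%E.
Proof. by move=> Cq XF; apply: ereal_inf_lbound; exists (q, X). Qed.

Lemma iota_setT {E : Type} {C : set E} {x : E} :
  C x -> iota_set (R := R) C x = 0%E.
Proof. by move=> Cx; rewrite /iota_set; case: asboolP. Qed.

Lemma iota_setF {E : Type} {C : set E} {x : E} :
  ~ C x -> iota_set (R := R) C x = +oo%E.
Proof. by move=> Cx; rewrite /iota_set; case: asboolP. Qed.

Lemma f1E p theta y u X : feasible M X -> nonneg (p + u) ->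
  (f1 M p theta u X - (dotp y u)%:E)%E = (total_cost p theta y (p + u) X)%:E.
Proof.
move=> XF q0; rewrite /f1 !iota_setT // !adde0 -!EFinD; congr (_%:E).
rewrite /dotp mulr_sumr -big_split -sumrB; apply: eq_bigr => j _ /=.
by rewrite /scenario_cost !mxE; ring.
Qed.

Lemma f1_infeasible p theta u X : ~ (feasible M X /\ nonneg (p + u)) ->
  f1 M p theta u X = +oo%E.
Proof.
move=> h; rewrite /f1; have [XF|XF] := pselect (feasible M X).
  rewrite (iota_setT XF) /= [X in (_ + X)%E]iota_setF // => q0.
  exact: h.
by rewrite (iota_setF XF) /= /iota_set; case: asboolP.
Qed.

Lemma psi1E p theta y : psi1 M p theta y = dual_value nonneg p theta y.
Proof.
apply/eqP; rewrite eq_le; apply/andP; split; apply: le_ereal_inf_tmp.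
  move=> _ [[q X] [/= q0 XF] <-]; apply: ereal_inf_lbound.
  by exists (q - p, X) => //=; rewrite f1E ?subrKC.
move=> _ [[u X] _ <-] /=.
have [[XF q0]|h] := pselect (feasible M X /\ nonneg (p + u)).
  by rewrite f1E //; exact: dual_value_le.
by rewrite f1_infeasible // leey.
Qed.

Lemma psi1tE p theta y :
  psi1t M p theta y = dual_value (nonneg_below p) p theta y.
Proof.
apply/eqP; rewrite eq_le; apply/andP; split; apply: le_ereal_inf_tmp.
  move=> _ [[q X] [/= q0 XF] <-]; apply: ereal_inf_lbound.
  exists (q - p, X) => //=; rewrite /f1t iota_setT ?adde0.
    rewrite f1E ?subrKC // => j; by have /andP[] := q0 j.
  by move=> j; rewrite !mxE subr_le0; have /andP[] := q0 j.
move=> _ [[u X] _ <-] /=; rewrite /f1t.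
have [[XF q0]|h] := pselect (feasible M X /\ nonneg (p + u)); last first.
  rewrite f1_infeasible //= /iota_set; case: asboolP => // _; exact: leey.
have [u0|u0] := pselect ([set x : 'rV[R]_m | forall j, x 0 j <= 0] u).
  rewrite (iota_setT u0) adde0 f1E //; apply: dual_value_le => // j.
  by rewrite (q0 j) /= mxE gerDl.
(* [addey] leaves the condition that [f1] is not -oo; it is finite in this case. *)
rewrite (iota_setF u0) addey; first exact: leey.
by rewrite /f1 !iota_setT.
Qed.

(** * Hypo-convergence from recovery sequences and uniform lower bounds *)

Section convergence.
Variables (p : 'rV[R]_m) (p_ : nat -> 'rV[R]_m).
Variables (theta : R) (theta_ : nat -> R).
Hypothesis hp : simplex p.
Hypothesis hp_ : forall nu, simplex (p_ nu).
Hypothesis cvg_p : p_ @ \oo --> p.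
Hypothesis theta_ge0 : 0 <= theta.
Hypothesis theta_ge0_ : forall nu, 0 <= theta_ nu.
Hypothesis cvg_theta : theta_ @ \oo --> theta.

Lemma total_cost_cvg (y_ : nat -> 'rV[R]_m) y (q_ : nat -> 'rV[R]_m) q X :
  y_ @ \oo --> y -> (forall j, q_ nu 0 j @[nu --> \oo] --> q 0 j) ->
  total_cost (p_ nu) (theta_ nu) (y_ nu) (q_ nu) X @[nu --> \oo]
    --> total_cost p theta y q X.
Proof.
move=> yy qq; apply: cvg_sumr => j; have pj := cvg_coord j cvg_p.
have yj := cvg_coord j yy; have qj := qq j.
rewrite /scenario_cost; apply: cvgD; last exact: cvgM.
apply: cvgD; first by apply: cvgM => //; apply: cvgB => //; exact: cvg_cst.
apply: cvgM; first by apply: cvgM => //; exact: cvg_cst.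
under eq_fun do rewrite expr2.
by rewrite expr2; apply: cvgM; exact: cvgB.
Qed.

(** Each pair admissible in the limit, approached by recovery pairs, bounds the limsup of the dual
    values from above. The lower bound must be uniform in q and X to survive the infimum at each nu;
    it is then used along the constant sequence y. *)
Lemma dual_value_hypo_converges (C : 'rV[R]_m -> set 'rV[R]_m) :
  (forall q, C p q -> exists2 q_ : nat -> 'rV[R]_m,
    (forall nu, C (p_ nu) (q_ nu)) &
    forall j, q_ nu 0 j @[nu --> \oo] --> q 0 j) ->
  (forall y, dual_value (C p) p theta y = -oo%E \/
    forall e : R, 0 < e -> \forall nu \near \oo, forall q X,
      C (p_ nu) q -> feasible M X ->
      (dual_value (C p) p theta y
        <= (total_cost (p_ nu) (theta_ nu) y q X + e)%:E)%E) ->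
  hypo_converges (fun nu => dual_value (C (p_ nu)) (p_ nu) (theta_ nu))
    (dual_value (C p) p theta).
Proof.
move=> recovery lower y; split.
  (* [limn_einf] is minus the [limn_esup] of the opposite sequence, so the goal is a limsup of dual
     values bounded by the limiting one. *)
  move=> y_ yy; rewrite /limn_einf leeN2; apply: le_ereal_inf_tmp.
  move=> _ [[q X] [/= Cq XF] <-]; apply/lee_addgt0Pr => e e0.
  apply: limn_esup_le_near; have [q_ Cq_ qq] := recovery q Cq.
  have cc := total_cost_cvg _ _ _ _ X yy qq.
  near=> nu; rewrite oppeK.
  apply: le_trans (dual_value_le (Cq_ nu) XF) _.
  rewrite -EFinD lee_fin; near: nu.
  by apply: (cvgr_le _ cc); rewrite ltrDl.
exists (fun=> y); first exact: cvg_cst.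
(* At dual value -oo the right-hand side is +oo. *)
have [->|low] := lower y; first by rewrite leey.
apply/lee_addgt0Pr => e e0; apply: limn_esup_le_near.
apply: filterS (low e e0) => nu H.
rewrite leeNl oppeD ?oppeK //; last by rewrite fin_num_adde_defl.
apply: le_ereal_inf_tmp => _ [[q X] [/= Cq XF] <-].
by rewrite EFinN leeBlDr // -EFinD; exact: H.
Unshelve. all: end_near. Qed.

(** * Recovery sequences for the orthant and for the box *)

Lemma recovery_nonneg q : nonneg q -> exists2 q_ : nat -> 'rV[R]_m,
  (forall nu, nonneg (q_ nu)) &
  forall j, q_ nu 0 j @[nu --> \oo] --> q 0 j.
Proof. by move=> q0; exists (fun=> q) => // j; exact: cvg_cst. Qed.

(** Clipping q at p^nu is admissible and converges to min(q, p) = q by continuity of the minimum. *)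
Lemma recovery_nonneg_below q : nonneg_below p q ->
  exists2 q_ : nat -> 'rV[R]_m,
    (forall nu, nonneg_below (p_ nu) (q_ nu)) &
    forall j, q_ nu 0 j @[nu --> \oo] --> q 0 j.
Proof.
move=> q0; exists (fun nu => \row_j Num.min (q 0 j) (p_ nu 0 j)).
  move=> nu j; rewrite mxE le_min ge_min lexx orbT andbT.
  by have /andP[-> _] := q0 j; have [->] := hp_ nu.
move=> j; under eq_fun do rewrite mxE.
have /andP[_ /min_idPl qp] := q0 j.
suff : Num.min (q 0 j) (p_ nu 0 j) @[nu --> \oo] --> Num.min (q 0 j) (p 0 j).
  by rewrite qp.
apply: cvg_comp2 (cvg_cst _) (cvg_coord j cvg_p) _.
exact: (@min_continuous _ R (q 0 j, p 0 j)).
Qed.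

(** * Lower bounds uniform in q and X *)

Definition gap (K A : R) y nu : R := \sum_j (K ^+ 2 * `|theta_ nu - theta|
  + (A + 2 * theta * K + `|y 0 j|) * `|p_ nu 0 j - p 0 j|).

(** [gap] sums the errors of [scenario_cost_perturb] and involves neither q nor X, so its smallness
    is uniform in both. *)
Lemma gap_near0 (K A : R) y (e : R) :
  0 < e -> \forall nu \near \oo, gap K A y nu <= e.
Proof.
move=> e0.
suff gap0 : gap K A y nu @[nu --> \oo] --> 0 by exact: (cvgr_le _ gap0).
have -> : 0 = \sum_(j < m) (K ^+ 2 * 0
    + (A + 2 * theta * K + `|y 0 j|) * 0).
  by rewrite big1 // => j _; rewrite !mulr0 addr0.
apply: cvg_sumr => j; apply: cvgD; apply: cvgM; try exact: cvg_cst.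
  by apply/norm_cvg0P; apply/subr_cvg0.
by apply/norm_cvg0P; apply/subr_cvg0; exact: cvg_coord.
Qed.

Lemma total_cost_perturb (K A : R) y nu q q' X :
  1 <= K -> 0 <= A -> (forall j, - A <= loss M j X - y 0 j) ->
  (forall j, [/\ 0 <= q' 0 j, q' 0 j <= q 0 j <= K &
    q 0 j - q' 0 j <= `|p_ nu 0 j - p 0 j|]) ->
  total_cost p theta y q' X
    <= total_cost (p_ nu) (theta_ nu) y q X + gap K A y nu.
Proof.
move=> K1 A0 aA H; rewrite /total_cost /gap -big_split /=.
apply: ler_sum => j _; have [q'0 q'q qd] := H j.
have /andP[pj0 pj1] := simplex_coord hp j.
have /andP[p_j0 p_j1] := simplex_coord (hp_ nu) j.
by apply: scenario_cost_perturb => //; apply/andP; split=> //; lra.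
Qed.

Lemma total_cost0 (p0 y q : 'rV[R]_m) X : total_cost p0 0 y q X =
  \sum_j q 0 j * (loss M j X - y 0 j) + dotp y p0.
Proof.
rewrite /total_cost /dotp -big_split; apply: eq_bigr => j _ /=.
by rewrite /scenario_cost mulr0 mul0r addr0.
Qed.

(** At theta = 0 the limiting cost is <y, p> plus a linear form in q with coefficients g_j(X) - y_j;
    the alternatives are whether some feasible X makes a coefficient negative. *)
Lemma lower_theta0 y : theta = 0 ->
  dual_value nonneg p theta y = -oo%E \/
  forall e : R, 0 < e -> \forall nu \near \oo, forall q X,
    nonneg q -> feasible M X ->
    (dual_value nonneg p theta y
      <= (total_cost (p_ nu) (theta_ nu) y q X + e)%:E)%E.
Proof.
move=> theta0.
have [[X [j [XF lj]]]|h] := pselect (exists X, exists j,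
    feasible M X /\ loss M j X < y 0 j).
  left; apply: eq_ninfty => r.
  (* Placing the mass t on scenario j alone brings the cost down to <y, p> - |<y, p> - r| <= r. *)
  pose t := `|dotp y p - r| / (y 0 j - loss M j X).
  have ylj : 0 < y 0 j - loss M j X by rewrite subr_gt0.
  pose q : 'rV[R]_m := \row_i (if i == j then t else 0).
  have q0 : nonneg q.
    by move=> i; rewrite mxE; case: ifP => // _; rewrite divr_ge0 // ltW.
  apply: le_trans (dual_value_le q0 XF) _.
  rewrite theta0 total_cost0 lee_fin (bigD1 j) //= big1 => [|i /negPf ij].
    rewrite mxE eqxx addr0 -opprB mulrN divfK ?gt_eqF //.
    have := ler_norm (dotp y p - r); lra.
  by rewrite mxE ij mul0r.
right=> e e0; near=> nu => q X q0 XF.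
apply: le_trans (dual_value_le (_ : nonneg 0) XF) _.
  by move=> j; rewrite mxE.
rewrite theta0 total_cost0 big1 ?add0r => [|j _]; last by rewrite mxE mul0r.
(* The perturbed cost is at least <y, p^nu>, as its other terms are nonnegative, and <y, p^nu> tends
   to <y, p>. *)
rewrite lee_fin; apply: (@le_trans _ _ (dotp y (p_ nu) + e)).
  rewrite -lerBlDr; near: nu; apply: (@cvgr_ge _ _ _ _ _ (dotp y p)).
    apply: cvg_sumr => j; apply: cvgM; first exact: cvg_cst.
    exact: cvg_coord.
  by rewrite ltrBlDr ltrDl.
rewrite lerD2r; apply: ler_sum => j _; rewrite /scenario_cost lerDr.
have yl : 0 <= loss M j X - y 0 j.
  by rewrite subr_ge0 leNgt; apply/negP => lj; apply: h; exists X, j.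
apply: addr_ge0; first exact: mulr_ge0.
by rewrite mulr_ge0 ?sqr_ge0 // mulr_ge0 // ?theta_ge0_ // invr_ge0.
Unshelve. all: end_near. Qed.

Lemma lower_theta_gt0 y : 0 < theta ->
  forall e : R, 0 < e -> \forall nu \near \oo, forall q X,
    nonneg q -> feasible M X ->
    (dual_value nonneg p theta y
      <= (total_cost (p_ nu) (theta_ nu) y q X + e)%:E)%E.
Proof.
move=> theta_gt0 e e0; have [A A0 HA] := feasible_loss_bounded y.
(* With this choice (theta/2)(K - 1) = A, so truncation at the same K is valid for every theta^nu >=
   theta/2. *)
pose K := 1 + 2 * A / theta.
have K1 : 1 <= K by rewrite lerDl divr_ge0 // mulr_ge0.
near=> nu => q X q0 XF.
have thetanu : theta / 2 <= theta_ nu.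
  by near: nu; apply: (cvgr_ge _ cvg_theta); rewrite ltr_pdivrMr //
    ltr_pMr // ltr1n.
have gape : gap K A y nu <= e by near: nu; exact: gap_near0.
pose q' : 'rV[R]_m := \row_j Num.min (q 0 j) K.
have q'0 j : 0 <= q' 0 j by rewrite mxE le_min q0 (le_trans ler01).
apply: le_trans (dual_value_le (q'0 : nonneg q') XF) _.
(* First p and theta are perturbed at the fixed truncated point, then the truncation is undone in
   the perturbed cost. *)
rewrite lee_fin; apply: (@le_trans _ _
    (total_cost (p_ nu) (theta_ nu) y q' X + gap K A y nu)).
  apply: total_cost_perturb => // j; first exact: HA.
  by split=> //; rewrite ?subrr // lexx /= mxE ge_min lexx orbT.
apply: lerD => //; apply: ler_sum => j _; rewrite mxE.
apply: (@scenario_cost_truncate _ _ A) => //; last 2 first.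
- exact: HA.
- rewrite /K addrAC subrr add0r.
  have {1}-> : A = theta / 2 * (2 * A / theta) by field; rewrite gt_eqF.
  by apply: ler_wpM2r => //; rewrite divr_ge0 // mulr_ge0.
by have /andP[] := simplex_coord (hp_ nu) j.
Unshelve. all: end_near. Qed.

(** The box lies in [0, 1], so K = 1 serves for any theta >= 0. Since q <= p^nu, passing to min(q,
    p) moves each coordinate by at most |p^nu_j - p_j|. *)
Lemma lower_below y (e : R) : 0 < e -> \forall nu \near \oo, forall q X,
  nonneg_below (p_ nu) q -> feasible M X ->
  (dual_value (nonneg_below p) p theta y
    <= (total_cost (p_ nu) (theta_ nu) y q X + e)%:E)%E.
Proof.
move=> e0; have [A A0 HA] := feasible_loss_bounded y.
near=> nu => q X qp XF.
have gape : gap 1 A y nu <= e by near: nu; exact: gap_near0.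
pose q' : 'rV[R]_m := \row_j Num.min (q 0 j) (p 0 j).
have q'p : nonneg_below p q'.
  move=> j; rewrite mxE le_min ge_min lexx orbT andbT.
  by have /andP[-> _] := qp j; have [->] := hp.
apply: le_trans (dual_value_le q'p XF) _.
rewrite lee_fin; apply: (@le_trans _ _
    (total_cost (p_ nu) (theta_ nu) y q X + gap 1 A y nu)); last first.
  by rewrite lerD2l.
apply: total_cost_perturb => // j; first exact: HA.
have /andP[q'0 _] := q'p j; split => //.
  have /andP[_ p1] := simplex_coord (hp_ nu) j.
  have /andP[_ qpj] := qp j.
  by rewrite mxE ge_min lexx /= (le_trans qpj).
rewrite mxE; have /andP[_ qpj] := qp j; case: (leP (q 0 j)) => qj.
  by rewrite subrr.
by apply: le_trans (ler_norm _); rewrite lerD2r.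
Unshelve. all: end_near. Qed.

End convergence.
End dual_values.

Theorem theorem4p5 (R : realType) (T k m : nat)
    (hT : (1 <= T)%N) (hk : (1 <= k)%N)
    (tr : scenario_tree T m) (M : market R k tr)
    (p : 'rV[R]_m) (p_ : nat -> 'rV[R]_m) (theta : R) (theta_ : nat -> R)
    (hp : simplex p)
    (hp_crit : forall j, j \in critical tr -> p 0 j = 0)
    (harb : arbitrage_free M p)
    (hp_ : forall nu, simplex (p_ nu))
    (cvg_p : p_ @ \oo --> p)
    (htheta : 0 <= theta)
    (htheta_ : forall nu, 0 <= theta_ nu)
    (cvg_theta : theta_ @ \oo --> theta) :
  [/\ theta = 0 ->
        hypo_converges (fun nu => psi1 M (p_ nu) (theta_ nu)) (psi1 M p theta),
      0 < theta ->
        hypo_converges (fun nu => psi1 M (p_ nu) (theta_ nu)) (psi1 M p theta) &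
      hypo_converges (fun nu => psi1t M (p_ nu) (theta_ nu)) (psi1t M p theta)].
Proof.
have psi1_ : psi1 M p theta = dual_value M nonneg p theta.
  by apply/funext => y; exact: psi1E.
have psi1_nu : (fun nu => psi1 M (p_ nu) (theta_ nu))
    = fun nu => dual_value M nonneg (p_ nu) (theta_ nu).
  by apply/funext => nu; apply/funext => y; exact: psi1E.
have psi1t_ : psi1t M p theta = dual_value M (nonneg_below p) p theta.
  by apply/funext => y; exact: psi1tE.
have psi1t_nu : (fun nu => psi1t M (p_ nu) (theta_ nu))
    = fun nu => dual_value M (nonneg_below (p_ nu)) (p_ nu) (theta_ nu).
  by apply/funext => nu; apply/funext => y; exact: psi1tE.
rewrite psi1_ psi1_nu psi1t_ psi1t_nu; split=> [theta0|theta_gt0|].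
- apply: (dual_value_hypo_converges M _ _ _ _ cvg_p cvg_theta
    (fun=> nonneg)) => //.
    exact: recovery_nonneg.
  by move=> y; exact: lower_theta0.
- apply: (dual_value_hypo_converges M _ _ _ _ cvg_p cvg_theta
    (fun=> nonneg)) => //.
    exact: recovery_nonneg.
  by move=> y; right; exact: lower_theta_gt0.
(* Unlike the orthant, the constraint set here moves with p^nu. *)
- apply: (dual_value_hypo_converges M _ _ _ _ cvg_p cvg_theta
    nonneg_below) => //.
    by move=> q; exact: recovery_nonneg_below.
  by move=> y; right; exact: lower_below.
Qed.
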